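(* Let $\Bbbk$ be a field of characteristic $0$. For $i=1,\dots,h$ let $Y^i\in M_{s_i}(\Bbbk)^g$ be separated semisimple points, and let $L\in\mathbb{N}\cup\{0\}$. If, for each $i$, $(f^{(i)}_\ell)_{\ell=0}^L$ is a sequence of $\ell$-linear maps $f^{(i)}_\ell:(M_{s_i}(\Bbbk)^g)^\ell\to M_{s_i}(\Bbbk)$ satisfying the truncated canonical intertwining conditions $\mathrm{IC}_L(Y^i)$, then there exists $f\in\Bbbk\langle x_1,\dots,x_g\rangle$ such that $$\Delta^\ell_{Y^i}f=f^{(i)}_\ell$$ for all $1\le i\le h$ and $0\le\ell\le L$.
   Context: Operations on tuples are componentwise: $SZ=(SZ_1,\dots,SZ_g)$, $ZS=(Z_1S,\dots,Z_gS)$, $[S,Z]=SZ-ZS$ for $S\in M_s(\Bbbk)$, $Z\in M_s(\Bbbk)^g$. A point $Y\in M_s(\Bbbk)^g$ is irreducible if $Y_1,\dots,Y_g$ have no nontrivial common invariant subspace, and semisimple if it is similar (simultaneously conjugate by an element of $GL_s(\Bbbk)$) to a direct sum of irreducible points. Semisimple points $Y^1,\dots,Y^h$ are separated if, for $i\ne j$, no irreducible block of $Y^i$ is similar to an irreducible block of $Y^j$. $\mathcal{C}(Y)$ is the centralizer of $Y_1,\dots,Y_g$ in $M_s(\Bbbk)$. Truncated canonical intertwining conditions: for $L\ge1$, a sequence $(f_\ell)_{\ell=0}^L$ of $\ell$-linear maps $f_\ell:(M_s(\Bbbk)^g)^\ell\to M_s(\Bbbk)$ (with $f_0\in M_s(\Bbbk)$)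 satisfies $\mathrm{IC}_L(Y)$ if for all $Z^j\in M_s(\Bbbk)^g$: $f_1([S,Y])=[S,f_0]$ and $$f_\ell([S,Y],Z^1,\dots,Z^{\ell-1})=Sf_{\ell-1}(Z^1,\dots,Z^{\ell-1})-f_{\ell-1}(SZ^1,Z^2,\dots,Z^{\ell-1}),$$ $$f_\ell(\dots,Z^j,[S,Y],Z^{j+1},\dots)=f_{\ell-1}(\dots,Z^{j-1},Z^jS,Z^{j+1},\dots)-f_{\ell-1}(\dots,Z^j,SZ^{j+1},Z^{j+2},\dots),$$ $$f_\ell(Z^1,\dots,Z^{\ell-1},[S,Y])=f_{\ell-1}(Z^1,\dots,Z^{\ell-2},Z^{\ell-1}S)-f_{\ell-1}(Z^1,\dots,Z^{\ell-1})S$$ for all $2\le\ell\le L$, $1\le j\le\ell-2$, $S\in M_s(\Bbbk)$, and moreover $$Sf_L(Z^1,\dots)=f_L(SZ^1,\dots),\quad f_L(\dots,Z^jS,Z^{j+1},\dots)=f_L(\dots,Z^j,SZ^{j+1},\dots),\quad f_L(\dots,Z^LS)=f_L(\dots,Z^L)S$$ for all $1\le j\le L-1$ and $S\in\mathcal{C}(Y)$. For $L=0$, $(f_0)$ satisfies $\mathrm{IC}_0(Y)$ if $[f_0,\mathcal{C}(Y)]=0$. For $f\in\Bbbk\langle x\rangle$, $\Delta^0_Yf=f(Y)$, and $\Delta^\ell_Yf:(M_s(\Bbbk)^g)^\ell\to M_s(\Bbbk)$ is the $\ell$-linear map for which $\Delta^\ell_Yf(Z^1,\dots,Z^\ell)$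 is the top-right $s\times s$ block of $f$ evaluated at the $(\ell+1)\times(\ell+1)$ block upper bidiagonal point with diagonal blocks $Y$ and superdiagonal blocks $Z^1,\dots,Z^\ell$. *)

(* Defs.v *)
From HB Require Import structures.
From mathcomp Require Import all_boot all_order all_algebra.
From mathcomp Require Import finmap.
From mathcomp.multinomials Require Import monalg.

Set Implicit Arguments.
Unset Strict Implicit.
Unset Printing Implicit Defensive.

Import GRing.Theory.
Local Open Scope ring_scope.

Notation point k g n := {ffun 'I_g -> 'M[k]_n}.

(* k<x_1, ..., x_g>: the monoid algebra of the free monoid on 'I_g. *)
Notation free_alg k g := {malg k[{fmonom 'I_g}]}.

Section Points.
Variables (k : fieldType) (g : nat).

Definition lmul_pt n (S : 'M[k]_n) (Z : point k g n) : point k g n :=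
  [ffun c => S *m Z c].

Definition rmul_pt n (Z : point k g n) (S : 'M[k]_n) : point k g n :=
  [ffun c => Z c *m S].

Definition bracket n (S : 'M[k]_n) (Z : point k g n) : point k g n :=
  lmul_pt S Z - rmul_pt Z S.

Definition centralizes n (S : 'M[k]_n) (Y : point k g n) : Prop :=
  forall c, comm_mx S (Y c).

(* Matrices act on column vectors. *)
Definition irreducible_pt n (Y : point k g n) : Prop :=
  (0 < n)%N /\
  forall U : {vspace 'cV[k]_n},
    (forall c (u : 'cV[k]_n), u \in U -> Y c *m u \in U) ->
    U = 0%VS \/ U = fullv.

(* Heterogeneous in the sizes, so that it applies to points whose sizes are
   equal only propositionally; it is false when the sizes differ. *)
Definition similar_pt n m (X : point k g n) (Y : point k g m) : Prop :=
  exists (e : m = n) (P : 'M[k]_n),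
    P \in unitmx /\
    forall c, X c = P *m castmx (e, e) (Y c) *m invmx P.

Definition dsum_pt m (p : 'I_m -> nat) (B : forall a, point k g (p a)) :
    point k g (\sum_a p a) :=
  [ffun c => \mxdiag_a B a c].

Definition irreducible_decomposition n (Y : point k g n)
    m (p : 'I_m -> nat) (B : forall a, point k g (p a)) : Prop :=
  (forall a, irreducible_pt (B a)) /\ similar_pt Y (dsum_pt B).

Definition semisimple_pt n (Y : point k g n) : Prop :=
  exists m (p : 'I_m -> nat) (B : forall a, point k g (p a)),
    irreducible_decomposition Y B.

Definition separated_pts h (s : 'I_h -> nat) (Y : forall i, point k g (s i)) :
    Prop :=
  forall i j, i != j ->
  forall m (p : 'I_m -> nat) (B : forall a, point k g (p a))
         m' (p' : 'I_m' -> nat) (B' : forall b, point k g (p' b)),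
    irreducible_decomposition (Y i) B -> irreducible_decomposition (Y j) B' ->
    forall a b, ~ similar_pt (B a) (B' b).

(* The maps f_l : (M_n(k)^g)^l -> M_n(k), for all l; in a truncated statement
   only those with l <= L are constrained. *)
Definition map_seq n := forall l : nat, l.-tuple (point k g n) -> 'M[k]_n.

(* f_l (Z_1, ..., Z_l), where l is the length of the list Z. *)
Definition ap n (f : map_seq n) (Z : seq (point k g n)) : 'M[k]_n :=
  f (size Z) (in_tuple Z).

Definition multilinear_map n l (F : l.-tuple (point k g n) -> 'M[k]_n) : Prop :=
  forall (Z : l.-tuple (point k g n)) (j : 'I_l),
    linear (fun X : point k g n =>
      F [tuple if i == j then X else tnth Z i | i < l]).

(* The index l of each f_l is the length of its argument list; A and B are the
   arguments before and after the displayed ones. *)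
Definition IC n (L : nat) (Y : point k g n) (f : map_seq n) : Prop :=
  if L is 0%N then
    forall S, centralizes S Y -> comm_mx (ap f [::]) S
  else
  [/\ forall S, ap f [:: bracket S Y] = S *m ap f [::] - ap f [::] *m S,
      [/\ forall S Z1 B, ((size B).+2 <= L)%N ->
            ap f [:: bracket S Y, Z1 & B]
            = S *m ap f (Z1 :: B) - ap f (lmul_pt S Z1 :: B),
          forall S A Z1 Z2 B, ((size A + size B)%N.+3 <= L)%N ->
            ap f (A ++ [:: Z1, bracket S Y, Z2 & B])
            = ap f (A ++ [:: rmul_pt Z1 S, Z2 & B])
              - ap f (A ++ [:: Z1, lmul_pt S Z2 & B])
        & forall S A Z1, ((size A).+2 <= L)%N ->
            ap f (A ++ [:: Z1; bracket S Y])
            = ap f (A ++ [:: rmul_pt Z1 S]) - ap f (A ++ [:: Z1]) *m S]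
    & forall S, centralizes S Y ->
      [/\ forall Z1 B, (size B).+1 = L ->
            S *m ap f (Z1 :: B) = ap f (lmul_pt S Z1 :: B),
          forall A Z1 Z2 B, (size A + size B)%N.+2 = L ->
            ap f (A ++ [:: rmul_pt Z1 S, Z2 & B])
            = ap f (A ++ [:: Z1, lmul_pt S Z2 & B])
        & forall A Z1, (size A).+1 = L ->
            ap f (A ++ [:: rmul_pt Z1 S]) = ap f (A ++ [:: Z1]) *m S]].

Definition nc_eval n (f : free_alg k g) (X : point k g n) : 'M[k]_n :=
  \sum_(w <- msupp f) f@_w *: \prod_(c <- fmonom_val w) X c.

Definition bidiag_pt n l (Y : point k g n) (Z : l.-tuple (point k g n)) :
    point k g (\sum_(i < l.+1) n) :=
  [ffun c => \mxblock_(i < l.+1, j < l.+1)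
     (if i == j then Y c else if j == i.+1 :> nat then Z`_i c else 0)].

(* For l = 0 there is a single block and this is f(Y). *)
Definition nc_diff n l (Y : point k g n) (f : free_alg k g)
    (Z : l.-tuple (point k g n)) : 'M[k]_n :=
  submxblock (nc_eval f (bidiag_pt Y Z)) ord0 ord_max.

End Points.

(* Main.v *)
Require Import Defs.
From HB Require Import structures.
From mathcomp Require Import all_boot all_order all_algebra.
From mathcomp Require Import finmap.
From mathcomp.multinomials Require Import monalg.
From mathcomp Require Import zify.
From Stdlib Require Import Classical.

Set Implicit Arguments.
Unset Strict Implicit.
Unset Printing Implicit Defensive.

Import GRing.Theory.
Local Open Scope ring_scope.

(** Write [A] for the free algebra. The map sending [f] to its derivatives of
    order at most [L] at [Y] kills the ([L]+1)-st power of the ideal [J] of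
    polynomials vanishing at [Y], so interpolation proceeds along the powers
    of [J], correcting one order at a time.

    Suppose [f] already has the prescribed derivatives below order [l], and let
    [H] be the prescribed one of order [l] minus the one of [f]. The derivatives
    of a polynomial satisfy the intertwining conditions ([jet_transfers]), hence
    so does the difference; as it is zero below order [l], the map [H] vanishes
    when a direction is a bracket [[S, Y]], and it is balanced over the
    centralizer [C] of [Y]. By [leading_jet] such an [H] is the leading
    derivative of an element of the [l]-th power of [J]. Adding that element
    to [f] gives the next step ([interpolate_one]).

    For [leading_jet], expand [H] in matrix units. A multilinear map is a
    combination of products [a_0 Z_1 a_1 ... Z_l a_l] with matrices [a_i], and
    being balanced over [C] means that, slot by slot, the [a_i] commute with
    [C]. By the bicentralizer theorem, which is where semisimplicity enters,
    they are values at [Y] of polynomials [lift a_i]. Lifting every [a_i] and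
    putting the variable [x_c] for the coordinate [c] of [Z_i] does not give an
    element of a power of [J]; but the factor [x_c lift(a) - lift(Y_c a)] lies
    in [J] as soon as the value of [lift] is linear for the left multiplications
    by the [Y c], and its derivative in the direction [Z] is [Z_c a] plus two
    terms involving the derivative of [lift]. These extra terms cancel in the
    sum, because [H] vanishes on brackets ([peel_identity]). The factors are
    split off one at a time, starting with the last direction.

    A [lift] with the required linearity ([exists_lift]) comes from a complement
    of the algebra [{f(Y)}] in the matrix algebra that is stable under left
    multiplication by the [Y c] ([stable_complement]); the same projection
    proves the bicentralizer theorem ([projection_bicentral]).

    Several points are treated by a partition of unity. Separated points admit
    no nonzero intertwiner between their matrix modules, by Schur's lemma
    ([no_intertwiner]); this produces a polynomial equal to 1 at one point and
    to 0 at another ([separating_element]), and powers of such polynomials are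
    equal to 1 and to 0 up to order [L] ([partition_of_unity]). *)

(** * Linear extension from words to noncommutative polynomials *)

Section WordSum.
Variables (k : fieldType) (g : nat) (V : lmodType k).
Implicit Types (f : free_alg k g) (T : {fmonom 'I_g} -> V).

Definition word_sum T f : V := \sum_(w <- msupp f) f@_w *: T w.

Lemma word_sum_widen T f (d : {fset {fmonom 'I_g}}) :
  (msupp f `<=` d)%fset -> word_sum T f = \sum_(w <- d) f@_w *: T w.
Proof.
move=> le; rewrite [LHS](big_fset_incl _ le) => //= x _ /mcoeff_outdom ->.
by rewrite scale0r.
Qed.

Lemma word_sum_is_linear T : linear (word_sum T).
Proof.
move=> a f1 f2; pose d := (msupp f1 `|` msupp f2)%fset.
have le1 : (msupp f1 `<=` d)%fset by apply: fsubsetUl.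
have le2 : (msupp f2 `<=` d)%fset by apply: fsubsetUr.
have le12 : (msupp (a *: f1 + f2) `<=` d)%fset.
  apply: fsubset_trans (msuppD_le _ _) _.
  by rewrite fsubUset le2 andbT; apply: fsubset_trans (msuppZ_le _ _) le1.
rewrite (word_sum_widen _ le1) (word_sum_widen _ le2) (word_sum_widen _ le12).
rewrite scaler_sumr -big_split /=; apply: eq_bigr => w _.
by rewrite mcoeffD mcoeffZ scalerDl scalerA.
Qed.

HB.instance Definition _ T :=
  GRing.isLinear.Build k (free_alg k g) V _ (word_sum T) (word_sum_is_linear T).

Lemma word_sumU T a w : word_sum T << a *g w >> = a *: T w.
Proof. by rewrite (word_sum_widen _ msuppU_le) big_seq_fset1 mcoeffUU. Qed.

Lemma word_sumM T f1 f2 :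
  word_sum T (f1 * f2) =
  \sum_(v <- msupp f1) \sum_(w <- msupp f2) (f1@_v * f2@_w) *: T (mmul v w).
Proof.
rewrite malgME linear_sum; apply: eq_bigr => v _.
by rewrite linear_sum; apply: eq_bigr => w _; rewrite /= word_sumU.
Qed.

End WordSum.

(** * Higher noncommutative derivatives as functions of lists of directions *)

Section Jets.
Variables (k : fieldType) (g n : nat).
Notation pt := (point k g n).
Notation A := (free_alg k g).
Implicit Types (w : seq 'I_g) (f p q : A) (S : 'M[k]_n).
Implicit Types (Y X : pt) (Z P B : seq pt).

(** The sum over all ways of replacing, from left to right, some letters of the
    word by the successive directions, all used, and the others by [Y]. *)
Fixpoint word_jet Y w Z : 'M[k]_n :=
  if w is c :: w' then
    Y c *m word_jet Y w' Z
    + (if Z is Z1 :: Z' then Z1 c *m word_jet Y w' Z' else 0)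
  else if Z is [::] then 1%:M else 0.

Definition jet Y f Z : 'M[k]_n :=
  word_sum (fun w : {fmonom 'I_g} => word_jet Y w Z) f.

Lemma jetD Y p q Z : jet Y (p + q) Z = jet Y p Z + jet Y q Z.
Proof. exact: linearD. Qed.

Lemma jetB Y p q Z : jet Y (p - q) Z = jet Y p Z - jet Y q Z.
Proof. exact: linearB. Qed.

Lemma jetZ Y a p Z : jet Y (a *: p) Z = a *: jet Y p Z.
Proof. exact: linearZ. Qed.

Lemma jet_sum Y (I : Type) (r : seq I) (P : pred I) (F : I -> A) Z :
  jet Y (\sum_(i <- r | P i) F i) Z = \sum_(i <- r | P i) jet Y (F i) Z.
Proof. exact: linear_sum. Qed.

Lemma jet1 Y Z : jet Y 1 Z = if Z is [::] then 1%:M else 0.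
Proof. by rewrite /jet word_sumU scale1r fm1. Qed.

Definition nc_var (c : 'I_g) : A := << fmu c >>.

Lemma jet_var Y c Z :
  jet Y (nc_var c) Z =
  match Z with [::] => Y c | [:: X] => X c | _ => 0 end.
Proof.
rewrite /jet word_sumU scale1r fmU /=.
case: Z => [|X [|X' Z]] /=; first by rewrite mulmx1 addr0.
  by rewrite mulmx0 add0r mulmx1.
by rewrite !mulmx0 addr0.
Qed.

Lemma word_jet_cat Y v w Z :
  word_jet Y (v ++ w) Z =
  \sum_(i < (size Z).+1) word_jet Y v (take i Z) *m word_jet Y w (drop i Z).
Proof.
elim: v Z => [|c v IH] Z /=.
  rewrite big_ord_recl /= take0 drop0 mul1mx big1 ?addr0 // => i _.
  by case: Z i => [[]//|X Z] i /=; rewrite mul0mx.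
rewrite IH mulmx_sumr.
case: Z => [|X Z] /=.
  by rewrite !addr0 !big_ord_recl !big_ord0 /= !addr0 mulmxA.
rewrite IH mulmx_sumr [RHS]big_ord_recl /= addr0.
under [X in _ = _ + X]eq_bigr do rewrite /= mulmxDl.
rewrite big_split /= [X in X + _ = _]big_ord_recl /= mulmxA -!addrA.
by do 2!congr (_ + _); apply: eq_bigr => i _; rewrite mulmxA.
Qed.

(** Leibniz rule: the directions are cut into those falling on [p] and those
    falling on [q]. *)
Lemma jetM Y p q Z :
  jet Y (p * q) Z =
  \sum_(i < (size Z).+1) jet Y p (take i Z) *m jet Y q (drop i Z).
Proof.
rewrite /jet word_sumM /word_sum.
under [RHS]eq_bigr => i _.
  rewrite mulmx_suml; under eq_bigr do rewrite mulmx_sumr; over.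
rewrite [RHS]exchange_big /=; apply: eq_bigr => v _.
rewrite [RHS]exchange_big /=; apply: eq_bigr => w _.
rewrite fmM word_jet_cat scaler_sumr; apply: eq_bigr => i _.
by rewrite -scalemxAl -scalemxAr scalerA.
Qed.

Lemma jetM_nil Y p q : jet Y (p * q) [::] = jet Y p [::] *m jet Y q [::].
Proof. by rewrite jetM big_ord_recl big_ord0 addr0. Qed.

Lemma jet_varM Y c p X :
  jet Y (nc_var c * p) [:: X] = Y c *m jet Y p [:: X] + X c *m jet Y p [::].
Proof. by rewrite jetM !big_ord_recl big_ord0 /= addr0 !jet_var. Qed.

Definition vanishes_below m Y f := forall Z, (size Z < m)%N -> jet Y f Z = 0.

Lemma vanishes_belowM m m' Y p q :
  vanishes_below m Y p -> vanishes_below m' Y q ->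
  vanishes_below (m + m') Y (p * q).
Proof.
move=> hp hq Z ltZ; rewrite jetM big1 // => i _.
have lei : (i <= size Z)%N by rewrite -ltnS.
case: (ltnP i m) => [ltim|leim]; first by rewrite hp ?mul0mx // size_takel.
rewrite hq ?mulmx0 // size_drop -(ltn_add2l m) (leq_ltn_trans _ ltZ) //.
by rewrite -[leqRHS](subnKC lei) leq_add2r.
Qed.

Lemma vanishes_belowX m Y p : vanishes_below 1 Y p -> vanishes_below m Y (p ^+ m).
Proof.
move=> hp; elim: m => [//|m IH]; rewrite exprS -add1n.
exact: vanishes_belowM.
Qed.

(** In the Leibniz rule only the cut giving each factor its order of vanishing
    survives. *)
Lemma jetM_vanish m Y p q Z X :
  vanishes_below m Y p -> vanishes_below 1 Y q -> size Z = m ->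
  jet Y (p * q) (rcons Z X) = jet Y p Z *m jet Y q [:: X].
Proof.
move=> hp hq sZ; rewrite -{m}sZ in hp *.
rewrite jetM size_rcons (bigD1 (inord (size Z))) //= inordK //.
rewrite -cats1 take_size_cat // drop_size_cat // big1 ?addr0 // => i nei.
have : (i < (size Z).+2)%N by [].
have {nei} : i != size Z :> nat.
  by apply: contra nei => /eqP ei; apply/eqP/val_inj; rewrite /= inordK.
case: (ltngtP i (size Z)) => // [lti _ _|lti _ lei].
  by rewrite hp ?mul0mx // size_takel // size_cat; lia.
rewrite [jet Y q _]hq ?mulmx0 // size_drop size_cat /=; lia.
Qed.

Lemma word_jet_linear Y w P B : linear (fun X => word_jet Y w (P ++ X :: B)).
Proof.
elim: w P => [|c w IH] P a X X' /=.
  by case: P => [|? ?]; rewrite scaler0 addr0.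
case: P => [|X1 P] /=.
  rewrite (IH [::] a X X') !ffunE mulmxDl mulmxDr -scalemxAl -scalemxAr.
  by rewrite scalerDr addrACA.
rewrite (IH (X1 :: P) a X X') (IH P a X X') /= !mulmxDr -!scalemxAr.
by rewrite scalerDr addrACA.
Qed.

Lemma jet_direction_linear Y f P B : linear (fun X => jet Y f (P ++ X :: B)).
Proof.
move=> a X X'; rewrite /jet /word_sum scaler_sumr -big_split /=.
apply: eq_bigr => w _; rewrite word_jet_linear scalerDr !scalerA.
by rewrite [a * _]mulrC.
Qed.

End Jets.

(** * The block bidiagonal point *)

Section Bidiagonal.
Variables (k : fieldType) (g n l : nat) (Y : point k g n).
Variable (Z : l.-tuple (point k g n)).

(** Multiplying the last block column of a word on the left by the bidiagonal
    point only involves a block and the one below it. This is the recursion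
    that defines [word_jet], where the directions still to be used are those
    that follow the current block row. *)
Lemma word_jet_bidiag w (i : 'I_l.+1) :
  submxblock (\prod_(c <- w) bidiag_pt Y Z c) i ord_max =
  word_jet Y w (drop i Z).
Proof.
elim: w i => [|c w IH] i.
  rewrite big_nil /= -[1]/(1%:M) -(mxdiagZ 1) /mxdiag mxblockK.
  case: eqVneq => [->|nei].
    by rewrite conform_mx_id /= drop_oversize // size_tuple.
  have lti : (i < size Z)%N.
    by rewrite size_tuple ltn_neqAle nei -ltnS ltn_ord.
  by rewrite (drop_nth 0 lti).
rewrite big_cons -[_ * _]/(_ *m _).
rewrite -[X in _ *m X]submxblockK ffunE mul_mxblock mxblockK /=.
rewrite (bigD1 i) //= eqxx IH; congr (_ + _).
have [eil|nei] := eqVneq (i : nat) l.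
  rewrite drop_oversize ?size_tuple ?eil // big1 // => j nej.
  rewrite eq_sym (negPf nej) ifF ?mul0mx //.
  by apply/negP => /eqP jl; have := ltn_ord j; rewrite jl ltnn.
have lti : (i < l)%N by rewrite ltn_neqAle nei -ltnS ltn_ord.
rewrite (drop_nth 0) ?size_tuple //.
have vi : (inord i.+1 : 'I_l.+1) = i.+1 :> nat by rewrite inordK.
rewrite (bigD1 (inord i.+1)) /=; last by rewrite -val_eqE /= vi neq_ltn ltnSn orbT.
rewrite vi eqxx ifF; last by rewrite -val_eqE /= vi; apply/negP => /eqP; lia.
rewrite IH vi big1 ?addr0 // => j /andP[nej nej'].
rewrite eq_sym (negPf nej) ifF ?mul0mx //; apply/negP => /eqP jv.
by case/negP: nej'; rewrite -val_eqE /= vi jv.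
Qed.

Lemma nc_diff_jet f : nc_diff Y f Z = jet Y f Z.
Proof.
rewrite /nc_diff /nc_eval /jet /word_sum.
transitivity (\sum_(w <- msupp f)
    f@_w *: submxblock (\prod_(c <- fmonom_val w) bidiag_pt Y Z c) ord0 ord_max).
  apply/matrixP => a b; rewrite !(mxE, summxE).
  by apply: eq_bigr => w _; rewrite !mxE.
by apply: eq_bigr => w _; rewrite word_jet_bidiag drop0.
Qed.

End Bidiagonal.

(** * Intertwining conditions, one cut at a time *)

Section Intertwining.
Variables (k : fieldType) (g n : nat) (Y : point k g n).
Notation pt := (point k g n).
Implicit Types (S : 'M[k]_n) (X : pt) (P B Z : seq pt) (H : seq pt -> 'M[k]_n).

Definition multilinear_at l H := forall P B, (size P + size B).+1 = l ->
  linear (fun X => H (P ++ X :: B)).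

(** The four shapes of the intertwining conditions (the matrix [S] enters
    before, between or after the directions, or there are none) are one
    condition on the cut between the reversed prefix [P] and the suffix [B]:
    [S] is absorbed by the neighbouring direction on either side, or comes out
    of [H] when there is none. *)
Definition gap H S P B : 'M[k]_n :=
  (if P is X :: P' then H (catrev P' (rmul_pt X S :: B)) else S *m H B)
  - (if B is X :: B' then H (catrev P (lmul_pt S X :: B')) else H (rev P) *m S).

Definition transfers l H := forall S P B, (size P + size B)%N = l ->
  H (catrev P (bracket S Y :: B)) = gap H S P B.

Definition balanced l H := forall S P B, centralizes S Y ->
  (size P + size B)%N = l -> gap H S P B = 0.

Lemma gapB H H' S P B :
  gap (fun Z => H Z - H' Z) S P B = gap H S P B - gap H' S P B.
Proof.
by rewrite /gap; case: P B => [|X P] [|X' B];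
   rewrite ?mulmxBr ?mulmxBl !opprB addrACA [RHS]addrACA; congr (_ + _);
   rewrite addrC.
Qed.

(** If [S] centralizes [Y], the bracket of [S] with [Y] is zero, so the
    conditions between two levels imply the balancedness of the lower one. *)
Lemma transfers_balanced l H :
  transfers l H -> multilinear_at l.+1 H -> balanced l H.
Proof.
move=> hT hL S P B hS sz; rewrite -hT //.
have -> : bracket S Y = 0.
  by apply/ffunP => c; rewrite !ffunE hS subrr.
have lin := hL (rev P) B; rewrite size_rev sz in lin.
have /= := lin erefl (-1) 0 0; rewrite catrevE scaleN1r addNr => ->.
by rewrite scaleN1r addNr.
Qed.

Lemma rcons_catrev (T : Type) (s t : seq T) x :
  rcons (catrev s t) x = catrev s (rcons t x).
Proof. by rewrite !catrevE rcons_cat. Qed.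

(** By induction on the word. The induction removes the first letter, hence
    possibly the first direction, which is the last entry of the reversed
    prefix. *)
Lemma word_jet_transfers w l : transfers l (word_jet Y w).
Proof.
move=> S P B _.
have brE c : bracket S Y c = S *m Y c - Y c *m S by rewrite !ffunE.
elim: w P B => [|c w IH] P B.
  have nil0 P' X B' : word_jet Y [::] (catrev P' (X :: B')) = 0.
    by rewrite catrevE; case: (rev P').
  rewrite nil0 /gap; case: P B => [|X P] [|X' B]; rewrite ?nil0 ?subrr //=.
  - by rewrite mulmx1 mul1mx subrr.
  - by rewrite mulmx0 subrr.
  by rewrite mul0mx subrr.
elim/last_ind: P => [|P X _]; last first.
  have cE P' C : catrev (rcons P' X) C = X :: catrev P' C.
    by rewrite !catrevE rev_rcons.
  rewrite cE /= -cE !IH /gap rev_rcons.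
  by case: P => [|X1 P]; case: B => [|X2 B];
     rewrite ?rcons_cons ?cE /= ?cE /= ?ffunE !mulmxBr ?mulmxDl ?mulmxA;
     rewrite addrACA -opprD.
rewrite /= (IH [::] B) brE /gap; case: B => [|X B] /=; rewrite ?ffunE.
  rewrite !addr0 mulmxBr mulmxBl !mulmxA.
  by rewrite [LHS]addrC addrA subrK.
rewrite mulmxBr mulmxBl mulmxDr !mulmxA opprD.
rewrite [LHS]addrC addrA subrK.
by rewrite addrACA subrr addr0.
Qed.

Lemma jet_transfers f l : transfers l (jet Y f).
Proof.
move=> S P B sz; rewrite /jet /word_sum.
under eq_bigr => w _ do rewrite (@word_jet_transfers w l S P B sz).
rewrite /gap; under eq_bigr => w _ do rewrite scalerBr.
rewrite sumrB; congr (_ - _).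
  case: P {sz} => [|X P] //; rewrite mulmx_sumr.
  by apply: eq_bigr => w _; rewrite scalemxAr.
case: B {sz} => [|X B] //; rewrite mulmx_suml.
by apply: eq_bigr => w _; rewrite scalemxAl.
Qed.

End Intertwining.

(** * Realizing the lowest-order jet *)

Section UnitPoints.
Variables (k : fieldType) (g n : nat).
Notation pt := (point k g n).
Implicit Types (S : 'M[k]_n) (X Y : pt).

Definition unit_pt (c : 'I_g) (u v : 'I_n) : pt :=
  [ffun c' => if c' == c then delta_mx u v else 0].

Lemma pt_sumE (I : Type) (r : seq I) (Q : pred I) (F : I -> pt) c :
  (\sum_(i <- r | Q i) F i) c = \sum_(i <- r | Q i) F i c.
Proof. exact: sum_ffunE. Qed.

Lemma pt_sum_unit X :
  X = \sum_(c < g) \sum_(u < n) \sum_(v < n) X c u v *: unit_pt c u v.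
Proof.
apply/ffunP => c; rewrite pt_sumE (bigD1 c) //= [X in _ + X]big1 => [|c' nec]; last first.
  rewrite pt_sumE big1 // => u _; rewrite pt_sumE big1 // => v _.
  by rewrite !ffunE eq_sym (negPf nec) scaler0.
rewrite addr0 pt_sumE {1}(matrix_sum_delta (X c)); apply: eq_bigr => u _.
by rewrite pt_sumE; apply: eq_bigr => v _; rewrite !ffunE eqxx.
Qed.

Lemma linear_unit_pt (F : {linear pt -> 'M[k]_n}) X :
  F X = \sum_(c < g) \sum_(u < n) \sum_(v < n) X c u v *: F (unit_pt c u v).
Proof.
rewrite {1}(pt_sum_unit X) linear_sum; apply: eq_bigr => c _.
rewrite linear_sum; apply: eq_bigr => u _.
by rewrite linear_sum; apply: eq_bigr => v _; rewrite linearZ.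
Qed.

Lemma linear_pack (F : pt -> 'M[k]_n) :
  linear F -> exists F' : {linear pt -> 'M[k]_n}, F =1 F'.
Proof.
move=> linF.
by exists (HB.pack_for {linear pt -> 'M[k]_n} F
  (GRing.isLinear.Build k pt 'M[k]_n _ F linF)).
Qed.

Lemma mul_delta_entry m (M : 'M[k]_(n, m)) (u v a : 'I_n) b :
  (delta_mx u v *m M) a b = (a == u)%:R * M v b.
Proof.
rewrite mxE (bigD1 v) //= mxE eqxx andbT big1 ?addr0 // => i nei.
by rewrite mxE (negPf nei) andbF mul0r.
Qed.

Lemma entry_mul_delta m (M : 'M[k]_(m, n)) (u v b : 'I_n) a :
  (M *m delta_mx u v) a b = M a u * (b == v)%:R.
Proof.
rewrite mxE (bigD1 u) //= mxE eqxx big1 ?addr0 // => i nei.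
by rewrite mxE (negPf nei) mulr0.
Qed.

Lemma lmul_unit_pt S c u v :
  lmul_pt S (unit_pt c u v) = \sum_(w < n) S w u *: unit_pt c w v.
Proof.
apply/ffunP => c'; rewrite pt_sumE !ffunE; case: eqP => [->|nec]; last first.
  rewrite mulmx0 big1 // => w _; rewrite !ffunE; case: eqP => // _.
  by rewrite scaler0.
apply/matrixP => a b; rewrite entry_mul_delta summxE (bigD1 a) //=.
rewrite !ffunE eqxx !mxE eqxx /= big1 ?addr0 // => w new.
by rewrite !ffunE eqxx !mxE eq_sym (negPf new) mulr0.
Qed.

Lemma rmul_unit_pt S c u v :
  rmul_pt (unit_pt c u v) S = \sum_(w < n) S v w *: unit_pt c u w.
Proof.
apply/ffunP => c'; rewrite pt_sumE !ffunE; case: eqP => [->|nec]; last first.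
  rewrite mul0mx big1 // => w _; rewrite !ffunE; case: eqP => // _.
  by rewrite scaler0.
apply/matrixP => a b; rewrite mul_delta_entry summxE (bigD1 b) //=.
rewrite !ffunE eqxx !mxE eqxx andbT [LHS]mulrC big1 ?addr0 // => w new.
by rewrite !ffunE eqxx !mxE [b == w]eq_sym (negPf new) andbF mulr0.
Qed.

Lemma unit_bracket Y (F : {linear pt -> 'M[k]_n}) (w v : 'I_n) :
  F (bracket (delta_mx w v) Y) =
  \sum_(c < g) \sum_(t < n) Y c v t *: F (unit_pt c w t)
  - \sum_(c < g) \sum_(u < n) Y c u w *: F (unit_pt c u v).
Proof.
rewrite linear_unit_pt -sumrB; apply: eq_bigr => c _.
have E u t : bracket (delta_mx w v) Y c u t =
    (u == w)%:R * Y c v t - Y c u w * (t == v)%:R.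
  by rewrite !ffunE !mxE -mul_delta_entry -entry_mul_delta !mxE.
under eq_bigr => u _.
  under eq_bigr do rewrite E scalerBl.
  rewrite sumrB; over.
rewrite sumrB; congr (_ - _).
  rewrite (bigD1 w) //= [X in _ + X]big1 ?addr0 => [|u new].
    by apply: eq_bigr => t _; rewrite eqxx mul1r.
  by rewrite big1 // => t _; rewrite (negPf new) mul0r scale0r.
apply: eq_bigr => u _; rewrite (bigD1 v) //= eqxx mulr1 big1 ?addr0 // => t nev.
by rewrite (negPf nev) mulr0 scale0r.
Qed.

(** One direction of the reconstruction of a multilinear map. For a fixed row
    [p], the values of [F] on the matrix units with row index [u] form a matrix
    [Q c u], and [F X] is the sum of the rows [u] of the [X c *m Q c u]. In the
    use made below, [pr] fixes [Q c u] because it commutes with the centralizer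
    of [Y]. The two terms with [de] cancel after exchanging the sums, because
    [F] is zero on the bracket of [delta_mx w v] with [Y]. *)
Lemma peel_identity (F : {linear pt -> 'M[k]_n}) (Y X : pt)
    (pr de : {linear 'M[k]_n -> 'M[k]_n}) :
  (forall S, F (bracket S Y) = 0) ->
  (forall c p u, pr (\matrix_(v, q) F (unit_pt c u v) p q)
                 = \matrix_(v, q) F (unit_pt c u v) p q) ->
  \sum_(t : 'I_g * ('I_n * 'I_n))
    (\matrix_(p, u) F (unit_pt t.1 u t.2.1) p t.2.2)
    *m (Y t.1 *m de (delta_mx t.2.1 t.2.2) + X t.1 *m pr (delta_mx t.2.1 t.2.2)
        - de (Y t.1 *m delta_mx t.2.1 t.2.2)) = F X.
Proof.
move=> F0 prF; apply/matrixP => p r.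
pose Q c u := \matrix_(v, q) F (unit_pt c u v) p q.
pose th c M := Y c *m de M + X c *m pr M - de (Y c *m M).
have thS c u : th c (Q c u) =
    \sum_(vq : 'I_n * 'I_n) Q c u vq.1 vq.2 *: th c (delta_mx vq.1 vq.2).
  have th_lin : linear (th c).
    move=> a M M'; rewrite /th !(linearP, mulmxDr).
    by rewrite [X in X + _]addrACA [LHS]addrACA -!scalerDr.
  pose t' : {linear 'M[k]_n -> 'M[k]_n} :=
    HB.pack_for {linear 'M[k]_n -> 'M[k]_n} (th c)
      (GRing.isLinear.Build k _ _ _ (th c) th_lin).
  transitivity
      (t' (\sum_(vq : 'I_n * 'I_n) Q c u vq.1 vq.2 *: delta_mx vq.1 vq.2)).
    congr (th c _); rewrite [LHS]matrix_sum_delta.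
    exact: (pair_bigA _ (fun v q => Q c u v q *: delta_mx v q)).
  by rewrite linear_sum; apply: eq_bigr => vq _; rewrite linearZ.
transitivity (\sum_(c < g) \sum_(u < n) th c (Q c u) u r).
  rewrite summxE -(pair_bigA _ (fun c vq =>
    ((\matrix_(p, u) F (unit_pt c u vq.1) p vq.2)
     *m th c (delta_mx vq.1 vq.2)) p r)) /=.
  apply: eq_bigr => c _.
  under eq_bigr do rewrite mxE.
  rewrite exchange_big /=; apply: eq_bigr => u _.
  rewrite thS summxE; apply: eq_bigr => vq _.
  by rewrite !mxE.
have pr_part : \sum_(c < g) \sum_(u < n) (X c *m pr (Q c u)) u r = F X p r.
  rewrite [F X]linear_unit_pt summxE; apply: eq_bigr => c _.
  rewrite summxE; apply: eq_bigr => u _.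
  rewrite prF mxE summxE; apply: eq_bigr => v _.
  by rewrite !mxE.
have de_part : \sum_(c < g) \sum_(u < n) (Y c *m de (Q c u)) u r
               = \sum_(c < g) \sum_(u < n) de (Y c *m Q c u) u r.
  transitivity (\sum_(w < n)
      (de (\sum_(c < g) \sum_(u < n) Y c u w *: Q c u)) w r).
    under [RHS]eq_bigr => w _.
      rewrite linear_sum summxE.
      under eq_bigr do rewrite linear_sum summxE.
      over.
    rewrite [RHS]exchange_big /=; apply: eq_bigr => c _.
    rewrite [RHS]exchange_big /=; apply: eq_bigr => u _.
    by rewrite mxE; apply: eq_bigr => w _; rewrite linearZ mxE.
  rewrite [RHS]exchange_big /=; apply: eq_bigr => w _.
  rewrite -summxE -linear_sum; congr (de _ w r).
  apply/matrixP => v q; move: (F0 (delta_mx w v)).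
  rewrite unit_bracket => /matrixP/(_ p q).
  rewrite !mxE => /eqP; rewrite subr_eq0 => /eqP E.
  rewrite !summxE in E *; transitivity
      (\sum_(c < g) \sum_(u < n) (Y c u w *: F (unit_pt c u v)) p q).
    apply: eq_bigr => c _; rewrite summxE; apply: eq_bigr => u _.
    by rewrite !mxE.
  under eq_bigr do rewrite -summxE.
  rewrite -E; apply: eq_bigr => c _; rewrite summxE mxE.
  by apply: eq_bigr => t _; rewrite !mxE.
rewrite -pr_part.
transitivity (\sum_(c < g) \sum_(u < n) (Y c *m de (Q c u)) u r
   + \sum_(c < g) \sum_(u < n) (X c *m pr (Q c u)) u r
   - \sum_(c < g) \sum_(u < n) de (Y c *m Q c u) u r); last first.
  by rewrite de_part addrAC subrr add0r.
rewrite -big_split -sumrB; apply: eq_bigr => c _.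
rewrite -big_split -sumrB; apply: eq_bigr => u _.
by rewrite /th !mxE.
Qed.

End UnitPoints.

Section LeadingJet.
Variables (k : fieldType) (g n : nat) (Y : point k g n).
Notation pt := (point k g n).
Notation A := (free_alg k g).

Definition bicentralizes (T : 'M[k]_n) :=
  forall S, centralizes S Y -> comm_mx T S.

Variable lift : {linear 'M[k]_n -> A}.
Hypothesis lift_lmul : forall c M,
  jet Y (lift (Y c *m M)) [::] = Y c *m jet Y (lift M) [::].
Hypothesis lift_bicentral : forall T,
  bicentralizes T -> jet Y (lift T) [::] = T.

(** The map of one direction less that is left when the last direction is split
    off: in the expansion of [H] as a combination of products
    [a_0 Z_1 a_1 ... Z_l a_l], [peel] collects the products before the last
    direction, the last direction being a matrix unit whose row index becomes
    the column index of the value. *)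
Definition peel (H : seq pt -> 'M[k]_n) c v q Z : 'M[k]_n :=
  \matrix_(p, u) H (rcons Z (unit_pt k c u v)) p q.

(** Multiplying the last direction on the left by [S] acts on its row index,
    hence multiplies the peeled map on the right by [S]. So the last cut of
    [peel H] is the cut of [H] before its last direction; the cuts further to
    the left do not see the peeled direction. *)
Lemma gap_peel l (H : seq pt -> 'M[k]_n) c v q S P B p u :
  multilinear_at l.+1 H -> (size P + size B)%N = l ->
  gap (peel H c v q) S P B p u
  = gap H S P (rcons B (unit_pt k c u v)) p q.
Proof.
move=> linH sz; have brack (M N : 'M[k]_n) a b : (M - N) a b = M a b - N a b.
  by rewrite !mxE.
rewrite /gap !brack; congr (_ - _).
  case: P {sz} => [|X P].
    by rewrite !mxE; apply: eq_bigr => r _; rewrite !mxE.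
  by rewrite mxE rcons_catrev.
case: B sz => [|X B] sz; last by rewrite mxE rcons_catrev.
rewrite /= lmul_unit_pt catrevE.
have [|F FE] := @linear_pack _ _ _ (fun X => H (rev P ++ X :: [::])).
  by apply: linH; rewrite size_rev sz.
rewrite [H _]FE linear_sum summxE mxE; apply: eq_bigr => w _.
by rewrite linearZ !mxE -FE cats1 mulrC.
Qed.

Lemma multilinear_peel l (H : seq pt -> 'M[k]_n) c v q :
  multilinear_at l.+1 H -> multilinear_at l (peel H c v q).
Proof.
move=> linH P B sz a X X'; apply/matrixP => p u; rewrite !mxE !rcons_cat /=.
have := linH P (rcons B (unit_pt k c u v)); rewrite size_rcons addnS sz.
by move=> /(_ erefl a X X') /= ->; rewrite !mxE.
Qed.

Definition vanishes_on_brackets l (H : seq pt -> 'M[k]_n) :=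
  forall S P B, (size P + size B).+1 = l -> H (catrev P (bracket S Y :: B)) = 0.

(** The factor standing for the last direction; the subtracted term makes it
    vanish at [Y]. *)
Definition peel_factor c (M : 'M[k]_n) : A :=
  nc_var k c * lift M - lift (Y c *m M).

Lemma peel_factor_vanishes c M : vanishes_below 1 Y (peel_factor c M).
Proof.
case=> // _; rewrite jetB lift_lmul jetM_nil jet_var.
by rewrite subrr.
Qed.

(** By induction on [l]: the polynomial for [H] is the sum of the polynomials
    for the peeled maps, each times its [peel_factor]. The peeled maps inherit
    all hypotheses, [peel_identity] identifies the leading derivative, and the
    balancedness of [H] at its right end is what lets [lift] recover the
    matrices to the right of the last direction. *)
Lemma leading_jet l (H : seq pt -> 'M[k]_n) :
  multilinear_at l H -> vanishes_on_brackets l H -> balanced Y l H ->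
  exists f, vanishes_below l Y f /\ forall Z, size Z = l -> jet Y f Z = H Z.
Proof.
elim: l H => [|l IH] H linH H0 balH.
  exists (lift (H [::])); split=> // -[] // _.
  apply: lift_bicentral => S hS.
  by have /eqP := balH S [::] [::] hS erefl; rewrite subr_eq0 eq_sym => /eqP.
have peels (t : 'I_g * ('I_n * 'I_n)) : exists f, vanishes_below l Y f /\
    forall Z, size Z = l -> jet Y f Z = peel H t.1 t.2.1 t.2.2 Z.
  apply: IH; first exact: multilinear_peel.
    move=> S P B sz; apply/matrixP => p u; rewrite !mxE rcons_catrev.
    by rewrite rcons_cons H0 ?mxE // size_rcons addnS sz.
  move=> S P B hS sz; apply/matrixP => p u.
  by rewrite (gap_peel _ _ _ _ _ _ linH) // balH // ?mxE // size_rcons addnS sz.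
have [phi phiP] := fin_all_exists peels.
exists (\sum_t phi t * peel_factor t.1 (delta_mx t.2.1 t.2.2)).
split=> [Z ltZ|Z].
  rewrite jet_sum big1 // => t _; rewrite -[l.+1]addn1 in ltZ.
  have [van _] := phiP t.
  exact: (vanishes_belowM van (@peel_factor_vanishes _ _) ltZ).
case/lastP: Z => // Z X; rewrite size_rcons => -[sz].
have [|F FE] := @linear_pack _ _ _ (fun X => H (rcons Z X)).
  move=> a X1 X2 /=; rewrite -!cats1; apply: (linH Z [::]).
  by rewrite addn0 sz.
pose pr : {linear 'M[k]_n -> 'M[k]_n} :=
  word_sum (fun w : {fmonom 'I_g} => word_jet Y w [::]) \o lift.
pose de : {linear 'M[k]_n -> 'M[k]_n} :=
  word_sum (fun w : {fmonom 'I_g} => word_jet Y w [:: X]) \o lift.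
rewrite FE -(@peel_identity _ _ _ F Y X pr de).
- rewrite jet_sum; apply: eq_bigr => t _; have [van lead] := phiP t.
  rewrite (jetM_vanish _ van (@peel_factor_vanishes _ _)) // lead //.
  rewrite jetB jet_varM; congr (_ *m _).
  by apply/matrixP => p u; rewrite !mxE FE.
- by move=> S; rewrite -FE -cats1 -[Z]revK -catrevE H0 // size_rev addn0 sz.
- move=> c p u; apply: lift_bicentral => S hS; apply/matrixP => v q.
  have := balH S (rev (rcons Z (unit_pt k c u v))) [::] hS.
  rewrite size_rev size_rcons addn0 sz => /(_ erefl).
  rewrite /gap revK rev_rcons catrevE revK cats1.
  rewrite rmul_unit_pt.
  rewrite !FE linear_sum => /eqP; rewrite subr_eq0 => /eqP/matrixP/(_ p q).
  rewrite summxE => E; rewrite !mxE.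
  transitivity ((F (unit_pt k c u v) *m S) p q).
    by rewrite !mxE; apply: eq_bigr => w _; rewrite mxE.
  by rewrite -E; apply: eq_bigr => w _; rewrite linearZ !mxE.
Qed.

End LeadingJet.

(** * Semisimple points *)

Section Splitting.
Variables (k : fieldType) (g : nat).

(** An irreducible decomposition seen from inside: the blocks are embedded in
    and projected from the ambient space by intertwiners. *)
Definition splits n (Y : point k g n) m (p : 'I_m -> nat)
    (B : forall a, point k g (p a))
    (inj : forall a, 'M[k]_(n, p a)) (prj : forall a, 'M[k]_(p a, n)) :=
  [/\ forall a c, Y c *m inj a = inj a *m B a c,
      forall a c, prj a *m Y c = B a c *m prj a
    & \sum_a inj a *m prj a = 1%:M].

Lemma decomposition_splits n (Y : point k g n) m (p : 'I_m -> nat)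
    (B : forall a, point k g (p a)) :
  irreducible_decomposition Y B -> exists inj prj, splits Y B inj prj.
Proof.
case=> _ [e [P [uP YE]]]; case: n / e Y P uP YE => Y P uP YE.
have {}YE c : Y c = P *m (\mxdiag_a B a c) *m invmx P.
  by rewrite YE castmx_id ffunE.
exists (fun a => submxrow P a), (fun a => submxcol (invmx P) a); split.
- move=> a c; have : Y c *m P = P *m \mxdiag_a B a c by rewrite YE mulmxKV.
  rewrite -{1 2}[P]submxrowK mul_mxrow mul_mxrow_mxdiag => /eq_mxrowP/(_ a).
  by [].
- move=> a c.
  have : invmx P *m Y c = \mxdiag_a B a c *m invmx P.
    by rewrite YE -mulmxA mulKmx.
  rewrite -{1 2}[invmx P]submxcolK mul_mxdiag_mxcol mxcol_mul.
  by move=> /eq_mxcolP/(_ a).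
- by rewrite -mul_mxrow_mxcol submxrowK submxcolK mulmxV.
Qed.

Lemma mem_limg_mulmx n m (Q : 'M[k]_(n, m)) (v : 'cV[k]_n) :
  v \in limg (linfun (mulmx Q : 'cV[k]_m -> 'cV[k]_n)) <->
  exists u, v = Q *m u.
Proof.
split=> [/memv_imgP[u _ ->]|[u ->]]; first by exists u; rewrite lfunE.
by apply/memv_imgP; exists u; rewrite ?memvf // lfunE.
Qed.

Lemma mem_lker_mulmx n m (Q : 'M[k]_(n, m)) (u : 'cV[k]_m) :
  (u \in lker (linfun (mulmx Q : 'cV[k]_m -> 'cV[k]_n))) = (Q *m u == 0).
Proof. by rewrite memv_ker lfunE. Qed.

(** The image and the kernel of [Q] are invariant, so [Q] is bijective; the
    two sizes are then equal and [Q] is the similarity. *)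
Lemma schur n m (X : point k g n) (X' : point k g m) (Q : 'M[k]_(n, m)) :
  irreducible_pt X -> irreducible_pt X' ->
  (forall c, X c *m Q = Q *m X' c) -> Q != 0 -> similar_pt X X'.
Proof.
case=> _ irrX [_ irrX'] QX nzQ.
pose f := linfun (mulmx Q : 'cV[k]_m -> 'cV[k]_n).
have [j nzj] : exists j, Q *m (delta_mx j 0 : 'cV_m) != 0.
  have /existsP[j nzj] : [exists j, Q *m (delta_mx j 0 : 'cV_m) != 0].
    apply: contraT; rewrite negb_exists => /forallP Q0; case/negP: nzQ.
    apply/eqP/matrixP => a b; have := Q0 b; rewrite negbK => /eqP/matrixP.
    by move=> /(_ a 0); rewrite -colE !mxE.
  by exists j.
have img_full : limg f = fullv.
  case: (irrX (limg f)) => //.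
    move=> c v /mem_limg_mulmx[u ->]; apply/mem_limg_mulmx.
    by exists (X' c *m u); rewrite !mulmxA QX.
  move=> img0; case/negP: nzj.
  by rewrite -memv0 -img0; apply/mem_limg_mulmx; exists (delta_mx j 0).
have ker0 : lker f = 0%VS.
  case: (irrX' (lker f)) => //.
    move=> c u; rewrite !mem_lker_mulmx => /eqP Qu.
    by rewrite mulmxA -QX -mulmxA Qu mulmx0.
  by move=> kerT; case/negP: nzj; rewrite -mem_lker_mulmx -/f kerT memvf.
have e : m = n.
  have := limg_ker_dim f fullv; rewrite img_full ker0 capv0 dimv0 add0n.
  by rewrite !dimvf /dim /= !muln1 => ->.
have injQ (u : 'cV_m) : Q *m u = 0 -> u = 0.
  by move=> /eqP; rewrite -mem_lker_mulmx -/f ker0 memv0 => /eqP.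
clear irrX nzQ nzj img_full ker0 f; exists e.
case: n / e X Q QX injQ => X Q QX injQ.
exists Q; have uQ : Q \in unitmx.
  rewrite unitmxE unitfE -det_tr; apply/det0P => -[v nzv vQ].
  case/negP: nzv; rewrite -trmx_eq0; apply/eqP/injQ.
  by rewrite -[Q]trmxK -trmx_mul vQ trmx0.
by split=> // c; rewrite castmx_id -QX mulmxK.
Qed.

End Splitting.

Section Modules.
Variables (k : fieldType) (g n : nat) (Y : point k g n).
Notation W := 'M[k]_n.
Implicit Types (U N K : {vspace W}).

Definition lmul_stable U := forall c M, M \in U -> Y c *m M \in U.

Lemma lmul_stableD U K : lmul_stable U -> lmul_stable K -> lmul_stable (U + K).
Proof.
move=> sU sK c _ /memv_addP[M MU [M' M'K ->]].
by rewrite mulmxDr memv_add // ?sU ?sK.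
Qed.

Definition column_map r (E : 'M[k]_(n, r)) (j : 'I_n) (u : 'cV[k]_r) : W :=
  E *m u *m delta_mx 0 j.

Lemma column_map_linear r (E : 'M[k]_(n, r)) j : linear (column_map E j).
Proof.
by move=> a u v; rewrite /column_map mulmxDr mulmxDl -scalemxAr -scalemxAl.
Qed.

HB.instance Definition _ r (E : 'M[k]_(n, r)) j :=
  GRing.isLinear.Build k 'cV[k]_r W _ (column_map E j)
    (@column_map_linear r E j).

Definition column_space r (E : 'M[k]_(n, r)) j : {vspace W} :=
  limg (linfun (column_map E j)).

Lemma mem_column_space r (E : 'M[k]_(n, r)) j M :
  M \in column_space E j <-> exists u, M = column_map E j u.
Proof.
split=> [/memv_imgP[u _ ->]|[u ->]]; first by exists u; rewrite lfunE.
by apply/memv_imgP; exists u; rewrite ?memvf // lfunE.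
Qed.

Lemma sum_col_delta r (M : 'M[k]_(r, n)) :
  M = \sum_j col j M *m (delta_mx 0 j : 'rV_n).
Proof.
apply/matrixP => a b; rewrite summxE (bigD1 b) //= big1 ?addr0 => [|j nej].
  by rewrite mxE big_ord1 !mxE !eqxx mulr1.
by rewrite mxE big_ord1 !mxE [b == j]eq_sym (negPf nej) mulr0.
Qed.

Hypothesis ssY : semisimple_pt Y.

(** Under left multiplication by the [Y c], the space of matrices is a sum of
    copies of the irreducible blocks, one in each column. Such a copy meets a
    stable subspace trivially unless it lies inside it, so a stable [K] of
    maximal dimension among those meeting [N] trivially is a complement. *)
Lemma stable_complement N : lmul_stable N ->
  exists K, [/\ lmul_stable K, (N :&: K = 0)%VS & (N + K = fullv)%VS].
Proof.
move=> sN; case: ssY => m [p [B dec]].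
have [irr _] := dec; have [inj [prj [injY prjY sum1]]] := decomposition_splits dec.
suff grow d K : lmul_stable K -> (N :&: K = 0)%VS ->
    (\dim {:W} - \dim K <= d)%N ->
    exists K, [/\ lmul_stable K, (N :&: K = 0)%VS & (N + K = fullv)%VS].
  apply: (grow _ 0%VS _ _ (leqnn _)); last exact: capv0.
  by move=> c M; rewrite memv0 => /eqP->; rewrite mulmx0 mem0v.
elim: d K => [|d IH] K sK NK0 codim.
  exists K; split=> //; apply/eqP; rewrite eqEdim subvf /=.
  by apply: leq_trans (dimvS (addvSr N K)); rewrite -subn_eq0 -leqn0.
have [/forallP all_in|] :=
  boolP [forall a, [forall j, (column_space (inj a) j <= N + K)%VS]].
  exists K; split=> //; apply/vspaceP => M; rewrite memvf.
  rewrite -[M]mul1mx -sum1 mulmx_suml memv_suml // => a _.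
  rewrite -mulmxA [prj a *m M]sum_col_delta mulmx_sumr memv_suml // => j _.
  have /forallP/(_ j)/subvP := all_in a; apply.
  by apply/mem_column_space; exists (col j (prj a *m M)); rewrite mulmxA.
rewrite negb_forall => /existsP[a]; rewrite negb_forall => /existsP[j nsub].
have col0 u : column_map (inj a) j u \in (N + K)%VS -> u = 0.
  have sNK := lmul_stableD sN sK.
  pose V := (linfun (column_map (inj a) j) @^-1: (N + K))%VS.
  have memV v : (v \in V) = (column_map (inj a) j v \in (N + K)%VS).
    by rewrite -memv_preim lfunE.
  rewrite -memV; have [_ /(_ V)] := irr a; case=> [c v|->|VT].
  - rewrite !memV => /(sNK c); rewrite /column_map !mulmxA injY.
    by [].
  - by rewrite memv0 => /eqP.
  case/negP: nsub; apply/subvP => _ /mem_column_space[v ->].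
  by rewrite -memV VT memvf.
apply: (IH (K + column_space (inj a) j)%VS).
- apply: lmul_stableD => // c _ /mem_column_space[u ->].
  apply/mem_column_space; exists (B a c *m u).
  by rewrite /column_map !mulmxA injY.
- apply/eqP; rewrite -subv0; apply/subvP => M; rewrite memv_cap memv0.
  case/andP=> MN /memv_addP[M1 M1K [_ /mem_column_space[u ->] ME]].
  have u0 : u = 0.
    apply: col0; have -> : column_map (inj a) j u = M - M1.
      by rewrite ME addrAC subrr add0r.
    by rewrite memv_add // memvN.
  rewrite -memv0 -NK0 memv_cap MN ME u0 linear0 addr0 M1K //.
- have ltK : (\dim K < \dim (K + column_space (inj a) j)%VS)%N.
    rewrite ltn_neqAle dimvS ?addvSl // andbT.
    apply: contra nsub => /eqP dK.
    have /eqP KE : K == (K + column_space (inj a) j)%VS.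
      by rewrite eqEdim addvSl dK leqnn.
    apply: subv_trans (addvSr K _) _; rewrite -KE; exact: addvSr.
  have := dimvS (subvf (K + column_space (inj a) j)%VS); lia.
Qed.

Lemma stable_projection N : lmul_stable N ->
  exists pr : 'End(W), [/\ forall M, pr M \in N, forall M, M \in N -> pr M = M
    & forall c M, pr (Y c *m M) = Y c *m pr M].
Proof.
move=> sN; have [K [sK NK0 NKT]] := stable_complement sN.
have KN0 : (K :&: N = 0)%VS by rewrite capvC.
have dec M : daddv_pi N K M + daddv_pi K N M = M.
  by rewrite daddv_pi_add // NKT memvf.
have prK M : M \in K -> daddv_pi N K M = 0.
  move=> MK; apply: (addIr M); rewrite -{2}(daddv_pi_id KN0 MK) dec add0r.
  by [].
exists (daddv_pi N K); split=> [M|M MN|c M].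
- exact: memv_pi.
- exact: daddv_pi_id.
have piN : daddv_pi N K M \in N by apply: memv_pi.
have piK : daddv_pi K N M \in K by apply: memv_pi.
rewrite -[in LHS](dec M) mulmxDr linearD /= (prK _ (sK c _ piK)) addr0.
by rewrite (daddv_pi_id NK0 (sN c _ piN)).
Qed.

(** The bicentralizer theorem, for the module of matrices. For fixed columns
    [j] and [i], the part of [pr] going from the [j]-th column to the [i]-th is
    multiplication by a matrix that centralizes [Y], so it commutes with [T].
    Applied to a [pr] with image the algebra generated by the [Y c] and to
    [M = 1], this puts [T] in that algebra. *)
Lemma projection_bicentral (pr : 'End(W)) (T M : W) :
  (forall c M, pr (Y c *m M) = Y c *m pr M) ->
  bicentralizes Y T -> pr (T *m M) = T *m pr M.
Proof.
move=> prY bT.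
pose ga j i : W := \matrix_(a, b) pr (delta_mx b j) a i.
have pr_delta (R : W) b j a i :
    pr (R *m delta_mx b j) a i = (ga j i *m R) a b.
  have -> : R *m delta_mx b j = \sum_d R d b *: delta_mx d j.
    apply/matrixP => x y; rewrite entry_mul_delta summxE (bigD1 x) //= !mxE.
    by rewrite eqxx /= big1 ?addr0 // => d ned;
       rewrite !mxE eq_sym (negPf ned) mulr0.
  rewrite linear_sum summxE mxE; apply: eq_bigr => d _.
  by rewrite linearZ !mxE mulrC.
have cent j i : centralizes (ga j i) Y.
  move=> c; apply/matrixP => a b; rewrite -pr_delta prY !mxE.
  by apply: eq_bigr => d _; rewrite !mxE.
have prT b j : pr (T *m delta_mx b j) = T *m pr (delta_mx b j).
  apply/matrixP => a i; rewrite pr_delta -(bT _ (cent j i)) !mxE.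
  by apply: eq_bigr => d _; rewrite !mxE.
rewrite [M]matrix_sum_delta (linear_sum pr) !mulmx_sumr (linear_sum pr).
apply: eq_bigr => b _; rewrite (linear_sum pr) !mulmx_sumr (linear_sum pr).
by apply: eq_bigr => j _; rewrite -scalemxAr !(linearZ_LR pr) /= prT -scalemxAr.
Qed.

End Modules.

(** Take a subspace of maximal dimension among those contained in [Q]; excluded
    middle tells whether a subspace can still be enlarged. *)
Lemma vspace_of_linear_predicate (k : fieldType) (V : vectType k)
    (Q : V -> Prop) :
  Q 0 -> (forall a u v, Q u -> Q v -> Q (a *: u + v)) ->
  exists U : {vspace V}, forall u, u \in U <-> Q u.
Proof.
move=> Q0 QD.
suff grow d (U : {vspace V}) : (forall u, u \in U -> Q u) ->
    (\dim {:V} - \dim U <= d)%N ->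
    exists U : {vspace V}, forall u, u \in U <-> Q u.
  by apply: (grow _ 0%VS _ (leqnn _)) => u; rewrite memv0 => /eqP->.
elim: d U => [|d IH] U UQ codim.
  have /eqP UT : U == fullv by rewrite eqEdim subvf /= -subn_eq0 -leqn0.
  by exists U => u; split=> [/UQ//|_]; rewrite UT memvf.
have [[v nvU Qv]|none] := classic (exists2 v, v \notin U & Q v); last first.
  exists U => u; split=> [/UQ//|Qu]; apply/negPn/negP => nuU.
  by apply: none; exists u.
apply: (IH (U + <[v]>)%VS).
  move=> _ /memv_addP[u uU [_ /vlineP[a ->] ->]].
  by rewrite addrC; apply: QD => //; apply: UQ.
have ltU : (\dim U < \dim (U + <[v]>)%VS)%N.
  rewrite ltn_neqAle dimvS ?addvSl // andbT; apply: contra nvU => /eqP dU.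
  have /eqP UE : U == (U + <[v]>)%VS by rewrite eqEdim addvSl dU leqnn.
  by rewrite UE; apply: subvP (addvSr _ _) _ (memv_line v).
have := dimvS (subvf (U + <[v]>)%VS); lia.
Qed.

Section Lift.
Variables (k : fieldType) (g n : nat) (Y : point k g n).
Hypothesis ssY : semisimple_pt Y.

Lemma jet_nil_bicentral f : bicentralizes Y (jet Y f [::]).
Proof.
move=> S hS; have lin : multilinear_at 1 (jet Y f).
  by move=> P B _; apply: jet_direction_linear.
have := transfers_balanced (@jet_transfers _ _ _ Y f 0) lin hS.
move=> /(_ [::] [::] erefl)/eqP.
by rewrite /gap subr_eq0 => /eqP.
Qed.

(** [lift] sends a matrix to a polynomial whose value is the projection of the
    matrix on the algebra generated by the [Y c], along a complement that is
    stable under left multiplication. *)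
Lemma exists_lift :
  exists lift : {linear 'M[k]_n -> free_alg k g},
    (forall c M,
       jet Y (lift (Y c *m M)) [::] = Y c *m jet Y (lift M) [::]) /\
    (forall T, bicentralizes Y T -> jet Y (lift T) [::] = T).
Proof.
have [||N NP] := @vspace_of_linear_predicate k 'M[k]_n
    (fun M => exists f, jet Y f [::] = M).
- by exists 0; rewrite -(scale0r 0) jetZ scale0r.
- by move=> a _ _ [f <-] [f' <-]; exists (a *: f + f'); rewrite jetD jetZ.
have sN : lmul_stable Y N.
  move=> c _ /NP[f <-]; apply/NP; exists (nc_var k c * f).
  by rewrite jetM_nil jet_var.
have [pr [prN prid prY]] := stable_projection ssY sN.
have ex (t : 'I_n * 'I_n) : exists f, jet Y f [::] = pr (delta_mx t.1 t.2).
  exact/NP.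
have [phi phiP] := fin_all_exists ex.
pose lift (M : 'M[k]_n) : free_alg k g := \sum_t M t.1 t.2 *: phi t.
have lift_lin : linear lift.
  move=> a M M'; rewrite /lift scaler_sumr -big_split; apply: eq_bigr => t _.
  by rewrite !mxE scalerDl scalerA.
have liftE M : jet Y (lift M) [::] = pr M.
  rewrite [M in RHS]matrix_sum_delta pair_big linear_sum jet_sum.
  by apply: eq_bigr => t _; rewrite jetZ phiP linearZ.
exists (HB.pack_for {linear 'M[k]_n -> free_alg k g} lift
  (GRing.isLinear.Build k 'M[k]_n (free_alg k g) _ lift lift_lin)).
split=> [c M|T bT] /=; rewrite !liftE //.
rewrite -[T]mulmx1 (projection_bicentral _ prY) // prid //.
by apply/NP; exists 1; rewrite jet1.
Qed.

End Lift.

(** * Separating semisimple points to finite order *)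

Section Separation.
Variables (k : fieldType) (g : nat).
Notation A := (free_alg k g).

(** Both modules of matrices are sums of copies of the irreducible blocks, and
    Schur's lemma kills every component of [th] between two such copies. *)
Lemma no_intertwiner n n' (Y : point k g n) (Y' : point k g n')
    m (p : 'I_m -> nat) (B : forall a, point k g (p a))
    m' (p' : 'I_m' -> nat) (B' : forall b, point k g (p' b))
    (th : {linear 'M[k]_n' -> 'M[k]_n}) :
  irreducible_decomposition Y B -> irreducible_decomposition Y' B' ->
  (forall a b, ~ similar_pt (B a) (B' b)) ->
  (forall c M, th (Y' c *m M) = Y c *m th M) -> forall M, th M = 0.
Proof.
move=> dec dec' nsim thY M.
have [irr _] := dec; have [irr' _] := dec'.
have [inj [prj [injY prjY sum1]]] := decomposition_splits dec.
have [inj' [prj' [injY' prjY' sum1']]] := decomposition_splits dec'.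
(* The component of [th] from the [j]-th column of the block [b] of [Y'] to
   the [i]-th column of the block [a] of [Y]. *)
pose Q a b i j : 'M_(p a, p' b) :=
  \matrix_(x, y) (prj a *m th (inj' b *m delta_mx y j)) x i.
have Q0 a b i j : Q a b i j = 0.
  apply/eqP/negPn/negP => nzQ; apply: (nsim a b).
  apply: (schur (irr a) (irr' b) _ nzQ) => c; apply/matrixP => x y.
  have -> : (B a c *m Q a b i j) x y =
      (B a c *m (prj a *m th (inj' b *m delta_mx y j))) x i.
    by rewrite !mxE; apply: eq_bigr => z _; rewrite !mxE.
  rewrite mulmxA -prjY -mulmxA -thY mulmxA injY' -mulmxA.
  have -> : B' b c *m delta_mx y j =
      \sum_z B' b c z y *: (delta_mx z j : 'M_(p' b, n')).
    apply/matrixP => u v; rewrite mxE summxE (bigD1 y) //= big1 ?addr0.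
      rewrite (bigD1 u) //= big1 ?addr0; first by rewrite !mxE !eqxx.
      by move=> z nez; rewrite !mxE eq_sym (negPf nez) mulr0.
    by move=> z nez; rewrite !mxE (negPf nez) mulr0.
  rewrite mulmx_sumr linear_sum mulmx_sumr summxE mxE; apply: eq_bigr => z _.
  by rewrite -scalemxAr linearZ -scalemxAr !mxE mulrC.
have th_delta b y j : th (inj' b *m delta_mx y j) = 0.
  rewrite -[th _]mul1mx -sum1 mulmx_suml big1 // => a _.
  rewrite -mulmxA [prj a *m _](_ : _ = 0) ?mulmx0 //; apply/matrixP => x i.
  by have /matrixP/(_ x y) := Q0 a b i j; rewrite !mxE.
rewrite -[M]mul1mx -sum1' mulmx_suml linear_sum big1 // => b _ /=.
rewrite -mulmxA [prj' b *m M]matrix_sum_delta mulmx_sumr linear_sum big1 //.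
move=> y _; rewrite /= mulmx_sumr linear_sum big1 // => j _ /=.
by rewrite -scalemxAr linearZ /= th_delta scaler0.
Qed.

(** Let [N] be the set of values at [Y] of the polynomials that vanish at [Y'].
    It is a left ideal of the algebra generated by the [Y c], and the stable
    projection [pr] on it satisfies [T *m pr 1 = T] for [T] in [N]. Hence
    multiplication on the right by [1 - pr 1] kills [N], and the values at [Y]
    of [lift M], where [lift] is a lift for [Y'], become intertwining after this
    multiplication. By hypothesis they are then zero; as [lift 1] has value 1
    modulo [N], this says [pr 1 = 1]. *)
Lemma separating_element n n' (Y : point k g n) (Y' : point k g n') :
  semisimple_pt Y -> semisimple_pt Y' ->
  (forall th : {linear 'M[k]_n' -> 'M[k]_n},
     (forall c M, th (Y' c *m M) = Y c *m th M) -> forall M, th M = 0) ->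
  exists e : A, jet Y e [::] = 1%:M /\ jet Y' e [::] = 0.
Proof.
move=> ssY ssY' no_th.
have [||N NP] := @vspace_of_linear_predicate k 'M[k]_n
    (fun M => exists f, jet Y' f [::] = 0 /\ jet Y f [::] = M).
- by exists 0; split; rewrite -(scale0r 0) jetZ scale0r.
- move=> a _ _ [f [f0 <-]] [f' [f0' <-]]; exists (a *: f + f').
  by rewrite !jetD !jetZ f0 f0' scaler0 addr0.
have sN : lmul_stable Y N.
  move=> c _ /NP[f [f0 <-]]; apply/NP; exists (nc_var k c * f).
  by rewrite !jetM_nil f0 mulmx0 jet_var.
have [pr [prN prid prY]] := stable_projection ssY sN.
have annih T : T \in N -> T *m (1%:M - pr 1%:M) = 0.
  move=> TN; have [f [_ fT]] := (NP T).1 TN.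
  have bT : bicentralizes Y T by rewrite -fT; apply: jet_nil_bicentral.
  by rewrite mulmxBr -(projection_bicentral _ prY bT) mulmx1 prid // subrr.
have [lift [lift_lmul lift_bic]] := exists_lift ssY'.
pose th M : 'M[k]_n := jet Y (lift M) [::] *m (1%:M - pr 1%:M).
have th_lin : linear th.
  move=> a M M'; rewrite /th linearP jetD jetZ mulmxDl.
  by rewrite scalemxAl.
have th0 M : th M = 0.
  pose th' := HB.pack_for {linear 'M[k]_n' -> 'M[k]_n} th
    (GRing.isLinear.Build k 'M[k]_n' 'M[k]_n _ th th_lin).
  apply: (no_th th') => c {}M /=; rewrite /th mulmxA.
  apply/eqP; rewrite -subr_eq0 -mulmxBl; apply/eqP/annih/NP.
  exists (lift (Y' c *m M) - nc_var k c * lift M).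
  by rewrite !jetB !jetM_nil !jet_var lift_lmul subrr.
have bic1 : bicentralizes Y' 1%:M by move=> S _; rewrite /comm_mx mulmx1 mul1mx.
have : (jet Y (lift 1%:M) [::] - 1%:M) *m (1%:M - pr 1%:M) = 0.
  apply/annih/NP; exists (lift 1%:M - 1).
  by rewrite !jetB lift_bic // !jet1 subrr.
rewrite mulmxBl -/(th 1%:M) th0 mul1mx sub0r => /eqP.
rewrite oppr_eq0 subr_eq0 => /eqP e1.
have /NP[e [e0 eE]] : 1%:M \in N by rewrite e1; apply: prN.
by exists e.
Qed.

Lemma vanishes_below1 n (Y : point k g n) f :
  vanishes_below 1 Y f <-> jet Y f [::] = 0.
Proof. by split=> [h|h [|//]]; [apply: h | rewrite h]. Qed.

(** Let [E] be 1 at [Y i] and 0 at the other points. Its power [q] vanishes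
    to order [L] at these, and so does [1 - (1 - q) ^+ L.+1], which is a
    multiple of [q]; at [Y i] the latter is 1 up to a power of [1 - q], which
    vanishes there. *)
Lemma partition_of_unity h (s : 'I_h -> nat) (Y : forall i, point k g (s i)) L :
  (forall i, semisimple_pt (Y i)) -> separated_pts Y ->
  forall i, exists e : A,
    vanishes_below L.+1 (Y i) (e - 1) /\
    forall j, j != i -> vanishes_below L.+1 (Y j) e.
Proof.
move=> ssY sep i.
have pair j : exists e : A, j != i ->
    jet (Y i) e [::] = 1%:M /\ jet (Y j) e [::] = 0.
  have [->|nej] := eqVneq j i; first by exists 0.
  have [m [p [B dec]]] := ssY i; have [m' [p' [B' dec']]] := ssY j.
  have [|e eP] := @separating_element _ _ (Y i) (Y j) (ssY i) (ssY j).
    move=> th thY; apply: (no_intertwiner dec dec') thY.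
    by apply: sep dec dec'; rewrite eq_sym.
  by exists e.
have [e eP] := fin_all_exists pair.
pose E : A := \prod_(j | j != i) e j.
have jet_prod (j : 'I_h) (r : seq 'I_h) (Q : pred 'I_h) :
    jet (Y j) (\prod_(t <- r | Q t) e t) [::]
    = \prod_(t <- r | Q t) jet (Y j) (e t) [::].
  elim/big_rec2: _ => [|t M f _ <-]; first by rewrite jet1.
  by rewrite jetM_nil.
have Ei : jet (Y i) E [::] = 1%:M.
  rewrite jet_prod big1 // => j nej; by case: (eP j nej).
have Ej j : j != i -> jet (Y j) E [::] = 0.
  move=> nej; rewrite jet_prod.
  have : j \in index_enum 'I_h by rewrite mem_index_enum.
  case/splitPr => r1 r2; rewrite big_cat big_cons /= nej.
  by have [_ ->] := eP j nej; rewrite mul0r mulr0.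
pose q := E ^+ L.+1.
have q0 j : j != i -> vanishes_below L.+1 (Y j) q.
  by move=> nej; apply/vanishes_belowX/vanishes_below1/Ej.
have q1 : vanishes_below 1 (Y i) (1 - q).
  apply/vanishes_below1; rewrite jetB jet1 /q.
  suff -> : jet (Y i) (E ^+ L.+1) [::] = 1%:M by rewrite subrr.
  elim: L.+1 => [|m IH]; first by rewrite expr0 jet1.
  by rewrite exprS jetM_nil IH Ei mulmx1.
exists (1 - (1 - q) ^+ L.+1); split=> [|j nej].
  rewrite addrAC subrr sub0r => Z ltZ.
  by rewrite -scaleN1r jetZ (vanishes_belowX q1) // scaler0.
rewrite -[X in X - _](expr1n _ L.+1) subrXX_comm; last exact: commr_sym (commr1 _).
rewrite opprB addrC subrK mulr_sumr.
move=> Z ltZ; rewrite jet_sum big1 // => t _.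
by apply: (vanishes_belowM (q0 j nej) (m' := 0)) => //; rewrite addn0.
Qed.

End Separation.

(** * Interpolation *)

Section OnePoint.
Variables (k : fieldType) (g n : nat) (Y : point k g n).
Hypothesis ssY : semisimple_pt Y.
Variables (L : nat) (H : seq (point k g n) -> 'M[k]_n).
Hypothesis linH : forall l, (l <= L)%N -> multilinear_at l H.
Hypothesis transH : forall l, (l < L)%N -> transfers Y l H.
Hypothesis balH : balanced Y L H.

Lemma balanced_upto l : (l <= L)%N -> balanced Y l H.
Proof.
rewrite leq_eqVlt => /orP[/eqP->//|ltl].
by apply: transfers_balanced (transH ltl) (linH ltl).
Qed.

(** The error of an interpolant that is exact below level [m] vanishes on
    brackets at level [m], because the intertwining conditions express its
    values there by those of the level below; its leading part is then
    realized by [leading_jet]. *)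
Lemma interpolate_one l : (l <= L)%N ->
  exists f, forall Z, (size Z <= l)%N -> jet Y f Z = H Z.
Proof.
have [lift [lift_lmul lift_bic]] := exists_lift ssY.
suff step m : (m <= L.+1)%N ->
    exists f, forall Z, (size Z < m)%N -> jet Y f Z = H Z.
  by move=> lel; apply: (step l.+1).
elim: m => [|m IH] leL; first by exists 0.
have [f fH] := IH (ltnW leL).
pose E Z := H Z - jet Y f Z.
have linE : multilinear_at m E.
  move=> P B sz a X X'; rewrite /E (linH leL sz) jet_direction_linear.
  by rewrite scalerBr opprD addrACA.
have [||f' [van lead]] := leading_jet lift_lmul lift_bic linE.
- move=> S P B sz; case: m leL fH sz {IH linE} => // m leL fH [sz].
  rewrite /E (transH leL) // (@jet_transfers _ _ _ Y f m S P B sz) -gapB /gap.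
  have E0 Z : size Z = m -> H Z - jet Y f Z = 0.
    by move=> sZ; rewrite fH ?subrr // sZ.
  case: P sz => [|X P] sz; case: B sz => [|X' B] sz;
    rewrite !E0 ?mulmx0 ?mul0mx ?subrr //;
    by rewrite ?size_rev ?catrevE ?size_cat ?size_rev; move: sz => /=; lia.
- move=> S P B hS sz; rewrite /E gapB (balanced_upto leL hS sz).
  rewrite (transfers_balanced (@jet_transfers _ _ _ Y f m)) ?subrr //.
  by move=> P' B' _; apply: jet_direction_linear.
exists (f + f') => Z; rewrite ltnS leq_eqVlt jetD => /orP[/eqP sZ|ltZ].
  by rewrite lead // addrC subrK.
by rewrite van // addr0 fH.
Qed.

End OnePoint.

(** * The given maps as functions of lists *)

Section ListForm.
Variables (k : fieldType) (g n L : nat) (Y : point k g n).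
Variable F : map_seq k g n.

Lemma ap_tuple l (Z : l.-tuple (point k g n)) : ap F Z = F Z.
Proof.
case: Z => Z sZ; rewrite /ap /=.
have sE := eqP sZ; case: l / sE sZ => sZ.
by congr (F _); apply: val_inj.
Qed.

Lemma multilinear_ap l : multilinear_map (@F l) -> multilinear_at l (ap F).
Proof.
move=> linF P B sz a X X'.
have szl X0 : size (P ++ X0 :: B) = l by rewrite size_cat addnS.
have ltP : (size P < l)%N by rewrite -sz ltnS leq_addr.
pose Z0 : l.-tuple _ := Tuple (introT eqP (szl 0)).
have apE X0 : ap F (P ++ X0 :: B) =
    F [tuple if i == Ordinal ltP then X0 else tnth Z0 i | i < l].
  rewrite -ap_tuple; congr (ap F _).
  apply: (@eq_from_nth _ 0); first by rewrite size_tuple szl.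
  move=> i; rewrite szl => lti; rewrite -[i]/(val (Ordinal lti)).
  rewrite -[RHS]tnth_nth tnth_mktuple -val_eqE /= (tnth_nth 0) /= !nth_cat.
  case: ltngtP => // [lt|->]; last by rewrite subnn.
  by rewrite -(subnSK lt).
by rewrite !apE; apply: linF.
Qed.

Lemma IC_transfers : IC L Y F -> forall l, (l < L)%N -> transfers Y l (ap F).
Proof.
rewrite /IC; case: L => // L' [h0 [hl hm hr] _] l ltl S P B sz; rewrite /gap.
case: P sz => [|X P] sz; case: B sz => [|X' B] sz /=.
- exact: h0.
- by apply: hl; move: sz => /=; lia.
- by rewrite rev_cons -cats1 !catrevE hr //
     size_rev; move: sz => /=; lia.
- by rewrite !catrevE hm // size_rev; move: sz => /=; lia.
Qed.

Lemma IC_balanced : IC L Y F -> balanced Y L (ap F).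
Proof.
rewrite /IC; case: L => [h0|L' [_ _ hS]] S P B cS sz; rewrite /gap.
  case: P sz => // sz; case: B sz => // _.
  by rewrite h0 // subrr.
have [hl hm hr] := hS S cS; apply/eqP; rewrite subr_eq0; apply/eqP.
case: P sz => [|X P] sz; case: B sz => [|X' B] sz //=.
- by apply: hl; move: sz => /=; lia.
- rewrite rev_cons -cats1 !catrevE.
  by apply: hr; rewrite size_rev; move: sz => /=; lia.
- by rewrite !catrevE hm // size_rev; move: sz => /=; lia.
Qed.

End ListForm.

Theorem theorem6p12 (k : fieldType) (hk : [pchar k] =i pred0) (g h : nat)
  (s : 'I_h -> nat) (hs : forall i : 'I_h, (0 < s i)%N)
  (Y : forall i : 'I_h, point k g (s i))
  (hY : forall i : 'I_h, semisimple_pt (Y i))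
  (hsep : separated_pts Y)
  (L : nat)
  (F : forall i : 'I_h, map_seq k g (s i))
  (hF : forall (i : 'I_h) (l : nat), (l <= L)%N -> multilinear_map (F i l))
  (hIC : forall i : 'I_h, IC L (Y i) (F i)) :
  exists f : free_alg k g,
    forall (i : 'I_h) (l : nat), (l <= L)%N ->
    forall Z : l.-tuple (point k g (s i)),
      nc_diff (Y i) f Z = F i l Z.
Proof.
have one i : exists f : free_alg k g,
    forall Z, (size Z <= L)%N -> jet (Y i) f Z = ap (F i) Z.
  apply: (interpolate_one (hY i) _ (IC_transfers (hIC i)) (IC_balanced (hIC i))
    (leqnn L)) => l lel.
  exact/multilinear_ap/hF.
have [f fP] := fin_all_exists one.
have [e eP] := fin_all_exists (partition_of_unity L hY hsep).
exists (\sum_i f i * e i) => i l lel Z.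
have szZ : (size Z < L.+1)%N by rewrite size_tuple.
rewrite nc_diff_jet -ap_tuple -fP // jet_sum (bigD1 i) //= big1 ?addr0.
  have -> : f i * e i = f i + f i * (e i - 1) by rewrite mulrBr mulr1 addrC subrK.
  have [e1 _] := eP i; rewrite jetD [X in _ + X](_ : _ = 0) ?addr0 //.
  exact: (vanishes_belowM (m := 0) _ e1).
move=> j nej; have [_ e0] := eP j.
by apply: (vanishes_belowM (m := 0) _ (e0 i _)); rewrite // eq_sym.
Qed.
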